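(* Let $H$ be a Hopf algebra over a field $\Bbbk$ and let $(M,\lambda)$ be a partial $H$-module. Then the standard dilation $(\overline M,T_\lambda,\varphi)$ of $(M,\lambda)$ is the globalization of the geometric partial comodule $(M,H\bullet M,\pi_M,\rho_M)$ over the coalgebra $(H,\mu,u)$ in $\mathsf{Vect}_\Bbbk^{\mathrm{op}}$ associated with $(M,\lambda)$. (The globalization is the $H$-module $\overline M$ together with the linear map $\varphi:M\to\overline M$.)
   Context: A (left) partial module over $H=(H,\mu,u,\Delta,\varepsilon,S)$ is a vector space $M$ with a linear map $\lambda:H\otimes M\to M$, $h\otimes m\mapsto h\cdot m$, such that for all $m\in M$, $h,k\in H$: (1) $1_H\cdot m=m$; (2) $h\cdot(k_{(1)}\cdot(S(k_{(2)})\cdot m))=(hk_{(1)})\cdot(S(k_{(2)})\cdot m)$; (3) $k_{(1)}\cdot(S(k_{(2)})\cdot(h\cdot m))=k_{(1)}\cdot(S(k_{(2)})h\cdot m)$. A dilation of $(M,\lambda)$ is $(N,T,\theta)$ where $N$ is a (global) left $H$-module with action $\triangleright$, $T$ is an idempotent linear endomorphism of $N$ with $T(h_{(1)}\triangleright T(S(h_{(2)})\triangleright y))=h_{(1)}\triangleright T(S(h_{(2)})\triangleright T(y))$ for all $h\in H,y\in N$, and $\theta:M\to T(N)$ is a linear isomorphism with $\theta(h\cdot m)=T(h\triangleright\theta(m))$. It is proper if $T(N)$ generates $N$ as $H$-module, and minimal if $N$ contains no non-zero $H$-submodule annihilated by $T$. The standard dilation is the proper minimal dilation (unique up to isomorphism)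 constructed as follows: $\mathrm{Hom}_\Bbbk(H,M)$ is a left $H$-module by $(h\triangleright f)(x)=f(xh)$; let $\varphi(m)(h)=h\cdot m$; then $\overline M$ is the $H$-submodule of $\mathrm{Hom}_\Bbbk(H,M)$ generated by $\varphi(M)$, and $T_\lambda(f)=\varphi(f(1_H))$. The geometric partial comodule (in $\mathsf{Vect}_\Bbbk^{\mathrm{op}}$) associated with $(M,\lambda)$ is given, in terms of linear maps, by $H\bullet M=\{\sum_i h_i\otimes m_i\in H\otimes M\mid \sum_i k\cdot(h_i\cdot m_i)=\sum_i kh_i\cdot m_i\ \forall k\in H\}$, $\pi_M:H\bullet M\to H\otimes M$ the inclusion, and $\rho_M:H\bullet M\to M$ the restriction of $\lambda$. A globalization of it (globalization of geometric partial comodules, spelled out in $\mathsf{Vect}_\Bbbk$) is a left $H$-module $Y$ with action $\nu:H\otimes Y\to Y$ and a linear map $\epsilon:M\to Y$ such that: (GL1) $\epsilon\circ\rho_M=\nu\circ(H\otimes\epsilon)\circ\pi_M$; (GL2) for every left $H$-module $(Z,\nu_Z)$ and every linear $g:M\to Z$ with $g\circ\rho_M=\nu_Z\circ(H\otimes g)\circ\pi_M$ there is a unique $H$-linear $\eta:Y\to Z$ with $\eta\circ\epsilon=g$; (GL3) $(H\bullet M,\rho_M,\pi_M)$ is the pullback in $\mathsf{Vect}_\Bbbk$ of $\epsilon:M\to Y$ and $\nu\circ(H\otimes\epsilon):H\otimes M\to Y$. *)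

(* Defs.v *)
From HB Require Import structures.
From mathcomp Require Import all_boot all_algebra.
From mathcomp Require Import boolp functions.
Set Implicit Arguments. Unset Strict Implicit. Unset Printing Implicit Defensive.
Import GRing.Theory.
Local Open Scope ring_scope.
Local Open Scope quotient_scope.

Local Notation bilinear_map F := (bilinear_for *:%R *:%R F).

Reserved Notation "U ⊗ V" (at level 39, left associativity).
Reserved Notation "h ▷ y" (at level 38, right associativity).
Reserved Notation "h • m" (at level 38, right associativity).
Reserved Notation "\tsum_ ( u , v <- t ) F"
  (at level 41, F at level 41, u name, v name, t at level 50,
   format "'[' \tsum_ ( u ,  v  <-  t ) '/  '  F ']'").

(* A formal sum \sum_i u_i ⊗ v_i is represented by the list of the pairs
   (u_i, v_i). Two formal sums are equal in U ⊗ V when every bilinear map takes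
   the same value on them; tsum_pure, tsum_linear and tensor_linear_ext below
   give the universal property. *)
Section Tensor.
Variables (K : fieldType) (U V : lmodType K).

Definition formal_eval (W : lmodType K) (F : U -> V -> W) (s : seq (U * V)) : W :=
  \sum_(p <- s) F p.1 p.2.

Definition tensor_rel : rel (seq (U * V)) := fun s t =>
  `[< forall (W : lmodType K) (F : {bilinear U -> V -> W}),
        formal_eval F s = formal_eval F t >].

Lemma tensor_rel_refl : reflexive tensor_rel.
Proof. by move=> s; apply/asboolP. Qed.

Lemma tensor_rel_sym : symmetric tensor_rel.
Proof.
by move=> s t; apply/asboolP/asboolP => st W F; rewrite st.
Qed.

Lemma tensor_rel_trans : transitive tensor_rel.
Proof.
move=> t s r /asboolP st /asboolP tr; apply/asboolP => W F.
by rewrite st tr.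
Qed.

Canonical tensor_equiv :=
  EquivRel tensor_rel tensor_rel_refl tensor_rel_sym tensor_rel_trans.

Definition tensor := {eq_quot tensor_equiv}.
HB.instance Definition _ := Choice.on tensor.
HB.instance Definition _ := EqQuotient.on tensor.

Definition pure (u : U) (v : V) : tensor := \pi_tensor [:: (u, v)].

(* \tsum_(u, v <- t) F u v is \sum_i F u_i v_i for t = \sum_i u_i ⊗ v_i. It only
   makes sense for bilinear F, and then does not depend on the chosen expression
   of t as a sum of pure tensors (tsum_pi). *)
Definition tsum (W : lmodType K) (F : U -> V -> W) (t : tensor) : W :=
  formal_eval F (repr t).

Lemma formal_evalP (W : lmodType K) (F : U -> V -> W) s t :
  bilinear_map F -> s = t %[mod tensor] -> formal_eval F s = formal_eval F t.
Proof.
move=> bF /eqmodP /asboolP st.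
pose b := bilinear_isBilinear.Build K U V W *:%R *:%R F bF.
pose G : {bilinear U -> V -> W} := HB.pack F b.
exact: st G.
Qed.

Lemma tsum_pi (W : lmodType K) (F : U -> V -> W) s :
  bilinear_map F -> tsum F (\pi_tensor s) = \sum_(p <- s) F p.1 p.2.
Proof. by move=> bF; apply: formal_evalP => //; rewrite reprK. Qed.

Lemma tensor_ext (s t : tensor) :
  (forall (W : lmodType K) (F : U -> V -> W), bilinear_map F ->
     tsum F s = tsum F t) -> s = t.
Proof.
move=> st; rewrite -[s]reprK -[t]reprK; apply/eqmodP/asboolP => W F.
apply: st; split=> [v|u] a x y.
  by rewrite linearDl linearZl_LR.
by rewrite linearDr linearZr_LR.
Qed.

Definition tensor_zero : tensor := \pi_tensor [::].
Definition tensor_add (s t : tensor) : tensor := \pi_tensor (repr s ++ repr t).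
Definition tensor_scale (a : K) (t : tensor) : tensor :=
  \pi_tensor [seq (a *: p.1, p.2) | p <- repr t].
Definition tensor_opp (t : tensor) : tensor := tensor_scale (-1) t.

Lemma tsum0 (W : lmodType K) (F : U -> V -> W) :
  bilinear_map F -> tsum F tensor_zero = 0.
Proof. by move=> bF; rewrite tsum_pi // big_nil. Qed.

Lemma tsumD (W : lmodType K) (F : U -> V -> W) s t :
  bilinear_map F -> tsum F (tensor_add s t) = tsum F s + tsum F t.
Proof. by move=> bF; rewrite tsum_pi // big_cat. Qed.

Lemma tsumZ (W : lmodType K) (F : U -> V -> W) a t :
  bilinear_map F -> tsum F (tensor_scale a t) = a *: tsum F t.
Proof.
move=> bF; rewrite tsum_pi // big_map /tsum /formal_eval scaler_sumr.
apply: eq_bigr => p _ /=.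
by have /scalable_linear := bF.1 p.2; apply.
Qed.

Lemma tensor_addA : associative tensor_add.
Proof. by move=> r s t; apply: tensor_ext => W F bF; rewrite !tsumD // addrA. Qed.
Lemma tensor_addC : commutative tensor_add.
Proof. by move=> s t; apply: tensor_ext => W F bF; rewrite !tsumD // addrC. Qed.
Lemma tensor_add0 : left_id tensor_zero tensor_add.
Proof. by move=> t; apply: tensor_ext => W F bF; rewrite tsumD // tsum0 // add0r. Qed.
Lemma tensor_addN : left_inverse tensor_zero tensor_opp tensor_add.
Proof.
move=> t; apply: tensor_ext => W F bF.
by rewrite tsumD // tsumZ // tsum0 // scaleN1r addNr.
Qed.

HB.instance Definition _ :=
  GRing.isZmodule.Build tensor tensor_addA tensor_addC tensor_add0 tensor_addN.

Lemma tensor_scaleA a b t :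
  tensor_scale a (tensor_scale b t) = tensor_scale (a * b) t.
Proof. by apply: tensor_ext => W F bF; rewrite !tsumZ // scalerA. Qed.
Lemma tensor_scale1 : left_id 1 tensor_scale.
Proof. by move=> t; apply: tensor_ext => W F bF; rewrite tsumZ // scale1r. Qed.
Lemma tensor_scaleDr : right_distributive tensor_scale +%R.
Proof.
move=> a s t; apply: tensor_ext => W F bF.
by rewrite tsumZ // !tsumD // !tsumZ // scalerDr.
Qed.
Lemma tensor_scaleDl t : {morph tensor_scale^~ t : a b / a + b}.
Proof.
move=> a b; apply: tensor_ext => W F bF.
by rewrite tsumZ // tsumD // !tsumZ // scalerDl.
Qed.

HB.instance Definition _ := GRing.Zmodule_isLmodule.Build K tensor
  tensor_scaleA tensor_scale1 tensor_scaleDr tensor_scaleDl.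

Lemma tsum_linear (W : lmodType K) (F : U -> V -> W) :
  bilinear_map F -> linear (tsum F).
Proof. by move=> bF a s t; rewrite tsumD // tsumZ. Qed.

Lemma tsum_pure (W : lmodType K) (F : U -> V -> W) u v :
  bilinear_map F -> tsum F (pure u v) = F u v.
Proof. by move=> bF; rewrite tsum_pi // big_seq1. Qed.

Definition tlift (W : lmodType K) (F : U -> V -> W) (bF : bilinear_map F) :
    {linear tensor -> W} :=
  HB.pack (tsum F) (GRing.isLinear.Build K tensor W _ _ (tsum_linear bF)).

Lemma tlift_pure (W : lmodType K) (F : U -> V -> W) (bF : bilinear_map F) u v :
  tlift bF (pure u v) = F u v.
Proof. exact: tsum_pure. Qed.

Lemma pure_bilinear : bilinear_map pure.
Proof.
split=> [v|u] a x y; apply: tensor_ext => W F bF;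
  rewrite tsumD // tsumZ // !tsum_pure //.
  by rewrite bF.1.
by rewrite bF.2.
Qed.

HB.instance Definition _ :=
  bilinear_isBilinear.Build K U V tensor *:%R *:%R pure pure_bilinear.

Lemma tensor_sum (t : tensor) : t = \sum_(p <- repr t) pure p.1 p.2.
Proof.
rewrite -[RHS]/(tsum pure t); apply: tensor_ext => W F bF.
rewrite -[RHS]/(tlift bF _) linear_sum.
by apply: eq_bigr => p _; rewrite tlift_pure.
Qed.

Lemma tensor_linear_ext (W : lmodType K) (f g : {linear tensor -> W}) :
  (forall u v, f (pure u v) = g (pure u v)) -> f =1 g.
Proof.
move=> fg t; rewrite [t]tensor_sum !linear_sum /=.
by apply: eq_bigr => p _.
Qed.

Lemma tsum_comp (W : lmodType K) (f : {linear tensor -> W}) t :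
  tsum (fun u v => f (pure u v)) t = f t.
Proof. by rewrite [in RHS](tensor_sum t) linear_sum. Qed.

End Tensor.

Arguments tlift : simpl never.

Notation "U ⊗ V" := (tensor U V) : type_scope.
Notation "u ⊗ v" := (pure u v) : ring_scope.
Notation "\tsum_ ( u , v <- t ) F" := (tsum (fun u v => F) t) : ring_scope.

Section TensorMap.
Variables (K : fieldType) (U V U' V' : lmodType K).
Variables (f : {linear U -> U'}) (g : {linear V -> V'}).

Lemma tmap_bilinear : bilinear_map (fun u v => f u ⊗ g v).
Proof.
split=> [v|u] a x y; rewrite linearP; first by rewrite linearDl linearZl_LR.
by rewrite linearDr linearZr_LR.
Qed.

Definition tmap : {linear (U ⊗ V)%type -> (U' ⊗ V')%type} := tlift tmap_bilinear.

Lemma tmap_pure u v : tmap (u ⊗ v) = f u ⊗ g v.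
Proof. exact: tlift_pure. Qed.

End TensorMap.
Arguments tmap : simpl never.

Section Subspace.
Variables (K : fieldType) (V : lmodType K) (S : submodClosed V).

Record subspace := Subspace { subspace_val : V; _ : subspace_val \in S }.

HB.instance Definition _ := [isSub for subspace_val].
HB.instance Definition _ := [Choice of subspace by <:].
HB.instance Definition _ := [SubChoice_isSubLmodule of subspace by <:].

Definition incl : {linear subspace -> V} := \val.

Lemma subspace_val_linear : linear subspace_val.
Proof. by []. Qed.

Lemma subspaceP (x y : subspace) : subspace_val x = subspace_val y -> x = y.
Proof. exact: val_inj. Qed.

End Subspace.

Section HopfAlgebras.
Variable K : fieldType.

Record hopfAlgebra := HopfAlgebra {
  hopf_alg :> algType K;
  comul : {linear hopf_alg -> (hopf_alg ⊗ hopf_alg)%type};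
  counit : {linear hopf_alg -> K^o};
  antipode : {linear hopf_alg -> hopf_alg};
  comulA : forall h,
    \tsum_(h1, h2 <- comul h) \tsum_(a, b <- comul h1) (a ⊗ (b ⊗ h2)) =
    \tsum_(h1, h2 <- comul h) \tsum_(a, b <- comul h2) (h1 ⊗ (a ⊗ b));
  counitl : forall h, \tsum_(h1, h2 <- comul h) counit h1 *: h2 = h;
  counitr : forall h, \tsum_(h1, h2 <- comul h) counit h2 *: h1 = h;
  comul1 : comul 1 = 1 ⊗ 1;
  comulM : forall h k, comul (h * k) =
    \tsum_(h1, h2 <- comul h) \tsum_(k1, k2 <- comul k) (h1 * k1) ⊗ (h2 * k2);
  counit1 : counit 1 = 1;
  counitM : forall h k, counit (h * k) = counit h * counit k;
  antipodel : forall h,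
    \tsum_(h1, h2 <- comul h) antipode h1 * h2 = (counit h : K)%:A;
  antipoder : forall h,
    \tsum_(h1, h2 <- comul h) h1 * antipode h2 = (counit h : K)%:A
}.

End HopfAlgebras.

Section Modules.
Variables (K : fieldType) (H : algType K).

Record hmodule := HModule {
  hmod_sort :> lmodType K;
  hact : {linear (H ⊗ hmod_sort)%type -> hmod_sort};
  hact1 : forall y, hact (1 ⊗ y) = y;
  hactM : forall h k y, hact ((h * k) ⊗ y) = hact (h ⊗ hact (k ⊗ y))
}.

End Modules.

Notation "h ▷ y" := (hact _ (h ⊗ y)) : ring_scope.

Section ModuleTheory.
Variables (K : fieldType) (H : algType K).

Section OfBilinear.
Variables (Y : lmodType K) (a : H -> Y -> Y).
Hypothesis a_bilin : bilinear_map a.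
Hypothesis a1 : forall y, a 1 y = y.
Hypothesis aM : forall h k y, a (h * k) y = a h (a k y).

Let act : {linear (H ⊗ Y)%type -> Y} := tlift a_bilin.

Fact hmodule_of_act1 y : act (1 ⊗ y) = y.
Proof. by rewrite tlift_pure. Qed.

Fact hmodule_of_actM h k y : act ((h * k) ⊗ y) = act (h ⊗ act (k ⊗ y)).
Proof. by rewrite !tlift_pure. Qed.

Definition hmodule_of : hmodule H := HModule hmodule_of_act1 hmodule_of_actM.

Lemma hmodule_ofE (h : H) (y : hmodule_of) : h ▷ y = a h y.
Proof. exact: tlift_pure. Qed.

End OfBilinear.

Definition hstable (N : hmodule H) (S : submodClosed N) : Prop :=
  forall (h : H) y, y \in S -> h ▷ y \in S.

Section SubModule.
Variables (N : hmodule H) (S : submodClosed N) (S_stable : hstable S).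

Definition sub_act (h : H) (y : subspace S) : subspace S :=
  Subspace (S_stable h (valP y)).

Fact sub_act_bilinear : bilinear_map sub_act.
Proof.
split=> [v|u] a x y; apply: subspaceP; rewrite subspace_val_linear /=.
  by rewrite linearDl linearZl_LR linearP.
by rewrite linearDr linearZr_LR linearP.
Qed.

Fact sub_act1 y : sub_act 1 y = y.
Proof. by apply: val_inj; rewrite /= hact1. Qed.

Fact sub_actM h k y : sub_act (h * k) y = sub_act h (sub_act k y).
Proof. by apply: val_inj; rewrite /= hactM. Qed.

Definition sub_hmodule : hmodule H :=
  hmodule_of sub_act_bilinear sub_act1 sub_actM.

End SubModule.

Section Generated.
Variables (N : hmodule H) (A : N -> Prop).

Definition hgen_pred : {pred N} := fun y =>
  `[< forall S : submodClosed N, hstable S -> (forall x, A x -> x \in S) ->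
        y \in S >].

Fact hgen_closed : submod_closed hgen_pred.
Proof.
split; first by apply/asboolP => S _ _; exact: rpred0.
move=> a x y /asboolP Sx /asboolP Sy; apply/asboolP => S hS AS.
by apply: rpredD; [apply: rpredZ; exact: Sx|exact: Sy].
Qed.

Definition hgen : submodClosed N :=
  HB.pack hgen_pred (GRing.isSubmodClosed.Build K N hgen_pred hgen_closed).

Fact hgen_stable : hstable hgen.
Proof.
move=> h y /asboolP Sy; apply/asboolP => S hS AS.
by apply: (hS); exact: Sy.
Qed.

Lemma hgen_sub x : A x -> x \in hgen.
Proof. by move=> Ax; apply/asboolP => S _; apply. Qed.

End Generated.

Section Hom.
Variable V : lmodType K.

Definition hom_pred : {pred (H -> V)} := fun f => `[< linear f >].

Fact hom_closed : submod_closed hom_pred.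
Proof.
split.
  by apply/asboolP => a x y; rewrite -[RHS]/(a *: 0 + 0 : V) scaler0 addr0.
move=> a f g /asboolP lf /asboolP lg; apply/asboolP => b x y.
rewrite -[LHS]/(a *: f (b *: x + y) + g (b *: x + y)).
rewrite -[RHS]/(b *: (a *: f x + g x) + (a *: f y + g y)).
rewrite lf lg !scalerDr !scalerA [a * b]mulrC.
by rewrite -!addrA; congr (_ + _); rewrite addrCA.
Qed.

Definition hom_closed_pred : submodClosed (H -> V) :=
  HB.pack hom_pred (GRing.isSubmodClosed.Build K (H -> V) hom_pred hom_closed).

Definition homk := subspace hom_closed_pred.
HB.instance Definition _ := GRing.Lmodule.on homk.

Definition hom_fun (f : homk) : H -> V := \val f.
Coercion hom_fun : homk >-> Funclass.

Lemma hom_linear (f : homk) : linear f.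
Proof. by case: f => f lf; apply/asboolP. Qed.

Definition hom_of (f : H -> V) (lf : linear f) : homk :=
  @Subspace _ _ hom_closed_pred f (asboolT lf).

Lemma homP (f g : homk) : f =1 g -> f = g.
Proof. by move=> fg; apply: val_inj; apply/funext. Qed.

Fact hom_act_linear (h : H) (f : homk) : linear (fun x => f (x * h)).
Proof. by move=> a x y; rewrite mulrDl -scalerAl hom_linear. Qed.

Definition hom_act (h : H) (f : homk) : homk := hom_of (hom_act_linear h f).

Fact hom_act_bilinear : bilinear_map hom_act.
Proof.
split=> [f|h] a x y; apply: homP => z.
  rewrite -[LHS]/(hom_fun f (z * (a *: x + y))).
  by rewrite mulrDr -scalerAr hom_linear.
by [].
Qed.

Fact hom_act1 f : hom_act 1 f = f.
Proof. by apply: homP => z; rewrite -[LHS]/(hom_fun f (z * 1)) mulr1. Qed.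

Fact hom_actM h k f : hom_act (h * k) f = hom_act h (hom_act k f).
Proof. by apply: homP => z; rewrite -[LHS]/(hom_fun f (z * (h * k))) mulrA. Qed.

Definition hom_hmodule : hmodule H :=
  hmodule_of hom_act_bilinear hom_act1 hom_actM.

End Hom.

End ModuleTheory.

Section Pullback.
Variables (K : fieldType) (A B C P : lmodType K).

Definition is_pullback (f : {linear A -> C}) (g : {linear B -> C})
    (p : {linear P -> A}) (q : {linear P -> B}) : Prop :=
  f \o p =1 g \o q /\
  forall (W : lmodType K) (r : {linear W -> A}) (s : {linear W -> B}),
    f \o r =1 g \o s ->
    exists u : {linear W -> P},
      (p \o u =1 r /\ q \o u =1 s) /\
      forall u' : {linear W -> P}, p \o u' =1 r /\ q \o u' =1 s -> u' =1 u.

End Pullback.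

Section GeometricComodules.
Variables (K : fieldType) (H : algType K).

(* The data underlying a geometric partial comodule (X, H•X, pi, rho) over the
   coalgebra (H, mu, u) in Vect^op, with arrows written as linear maps: pi, an
   epimorphism of Vect^op, is an injective linear map. *)
Record partial_comodule_datum := PartialComoduleDatum {
  pcd_sort :> lmodType K;
  pcd_dom : lmodType K;
  pcd_pi : {linear pcd_dom -> (H ⊗ pcd_sort)%type};
  pcd_rho : {linear pcd_dom -> pcd_sort};
  pcd_pi_inj : injective pcd_pi
}.

Definition induced_action (V : lmodType K) (Z : hmodule H)
    (g : {linear V -> Z}) : {linear (H ⊗ V)%type -> Z} :=
  hact Z \o tmap (idfun : {linear H -> H}) g.

Definition hlinear (Y Z : hmodule H) (f : Y -> Z) : Prop :=
  forall (h : H) y, f (h ▷ y) = h ▷ f y.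

Record is_globalization (X : partial_comodule_datum) (Y : hmodule H)
    (eps : {linear X -> Y}) : Prop := IsGlobalization {
  glob_compat : eps \o pcd_rho X =1 induced_action eps \o pcd_pi X;
  glob_universal : forall (Z : hmodule H) (g : {linear X -> Z}),
    g \o pcd_rho X =1 induced_action g \o pcd_pi X ->
    exists eta : {linear Y -> Z},
      (hlinear eta /\ eta \o eps =1 g) /\
      forall eta' : {linear Y -> Z},
        hlinear eta' /\ eta' \o eps =1 g -> eta' =1 eta;
  glob_pullback : is_pullback eps (induced_action eps) (pcd_rho X) (pcd_pi X)
}.

End GeometricComodules.

Section PartialModules.
Variables (K : fieldType) (H : hopfAlgebra K).
Local Notation "'Δ'" := (@comul K H).
Local Notation "'S'" := (@antipode K H).

Record partial_module := PartialModule {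
  pmod_sort :> lmodType K;
  pact : {linear (H ⊗ pmod_sort)%type -> pmod_sort};
  pact1 : forall m, pact (1 ⊗ m) = m;
  pactMS : forall (h k : H) m,
    \tsum_(k1, k2 <- Δ k) pact (h ⊗ pact (k1 ⊗ pact (S k2 ⊗ m))) =
    \tsum_(k1, k2 <- Δ k) pact ((h * k1) ⊗ pact (S k2 ⊗ m));
  pactSM : forall (h k : H) m,
    \tsum_(k1, k2 <- Δ k) pact (k1 ⊗ pact (S k2 ⊗ pact (h ⊗ m))) =
    \tsum_(k1, k2 <- Δ k) pact (k1 ⊗ pact ((S k2 * h) ⊗ m))
}.

Notation "h • m" := (pact _ (h ⊗ m)) : ring_scope.

Record dilation (M : partial_module) := Dilation {
  dil_mod : hmodule H;
  dil_T : {linear dil_mod -> dil_mod};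
  dil_theta : {linear M -> dil_mod};
  dil_idem : forall y, dil_T (dil_T y) = dil_T y;
  dil_TS : forall (h : H) y,
    \tsum_(h1, h2 <- Δ h) dil_T (h1 ▷ dil_T (S h2 ▷ y)) =
    \tsum_(h1, h2 <- Δ h) (h1 ▷ dil_T (S h2 ▷ dil_T y));
  (* theta is a linear isomorphism of M onto T(N) *)
  dil_theta_inj : injective dil_theta;
  dil_theta_image : forall y, (exists m, dil_theta m = y) <-> (exists x, dil_T x = y);
  dil_theta_act : forall (h : H) m, dil_theta (h • m) = dil_T (h ▷ dil_theta m)
}.

Definition proper_dilation (M : partial_module) (D : dilation M) : Prop :=
  forall y : dil_mod D, y \in hgen (fun z => exists x, dil_T D x = z).

Definition minimal_dilation (M : partial_module) (D : dilation M) : Prop :=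
  forall W : submodClosed (dil_mod D), hstable W ->
    (forall y, y \in W -> dil_T D y = 0) -> forall y, y \in W -> y = 0.

Section Standard.
Variable M : partial_module.

Fact act_linear (h : H) : linear (fun m : M => h • m).
Proof. by move=> a x y; rewrite linearDr linearZr_LR linearP. Qed.

Fact orbit_linear (m : M) : linear (fun h : H => h • m).
Proof. by move=> a x y; rewrite linearDl linearZl_LR linearP. Qed.

Definition phi (m : M) : hom_hmodule H M := hom_of (orbit_linear m).

Fact phi_linear : linear phi.
Proof. by move=> a x y; apply: homP => h; exact: act_linear. Qed.

HB.instance Definition _ :=
  GRing.isLinear.Build K M (hom_hmodule H M) *:%R phi phi_linear.

Definition std_pred : submodClosed (hom_hmodule H M) :=
  hgen (fun f => exists m, phi m = f).

Fact std_stable : hstable std_pred.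
Proof. exact: hgen_stable. Qed.

Definition std_module : hmodule H := sub_hmodule std_stable.

Fact phi_std m : phi m \in std_pred.
Proof. by apply: hgen_sub; exists m. Qed.

Definition std_phi (m : M) : std_module := Subspace (phi_std m).

Fact std_phi_linear : linear std_phi.
Proof. by move=> a x y; apply: subspaceP; rewrite /= linearP. Qed.

HB.instance Definition _ :=
  GRing.isLinear.Build K M std_module *:%R std_phi std_phi_linear.

Definition std_fun (f : std_module) : H -> M :=
  hom_fun (subspace_val (f : subspace std_pred)).

Definition std_T (f : std_module) : std_module := std_phi (std_fun f 1).

Fact std_T_linear : linear std_T.
Proof. by move=> a f g; rewrite /std_T -linearP. Qed.

HB.instance Definition _ :=
  GRing.isLinear.Build K std_module std_module *:%R std_T std_T_linear.

Lemma hom_actE (h : H) (f : hom_hmodule H M) x :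
  hom_fun (h ▷ f) x = hom_fun f (x * h).
Proof. by rewrite [h ▷ f]hmodule_ofE. Qed.

Lemma std_val_act (h : H) (f : std_module) :
  subspace_val (h ▷ f : subspace std_pred) =
  h ▷ subspace_val (f : subspace std_pred).
Proof. by rewrite [in LHS]hmodule_ofE. Qed.

Lemma std_actE (h : H) (f : std_module) x :
  std_fun (h ▷ f) x = std_fun f (x * h).
Proof. by rewrite /std_fun std_val_act hom_actE. Qed.

Lemma std_sumE I (r : seq I) (F : I -> std_module) x :
  std_fun (\sum_(i <- r) F i) x = \sum_(i <- r) std_fun (F i) x.
Proof.
by elim: r => [|i r IH]; rewrite ?big_nil // !big_cons -IH.
Qed.

Lemma std_ext (f g : std_module) : std_fun f =1 std_fun g -> f = g.
Proof. by move=> fg; apply: subspaceP; exact: homP. Qed.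

Fact std_idem f : std_T (std_T f) = std_T f.
Proof. by rewrite /std_T /= [std_fun (std_phi _) 1]pact1. Qed.

Fact std_phi_inj : injective std_phi.
Proof.
move=> m n mn; rewrite -[m]pact1 -[n]pact1.
by rewrite -[LHS]/(std_fun (std_phi m) 1) mn.
Qed.

Fact std_image f : (exists m, std_phi m = f) <-> (exists g, std_T g = f).
Proof.
split=> [[m <-]|[g <-]]; last by exists (std_fun g 1).
by exists (std_phi m); rewrite /std_T [std_fun _ 1]pact1.
Qed.

Fact std_phi_act (h : H) m : std_phi (h • m) = std_T (h ▷ std_phi m).
Proof. by rewrite /std_T std_actE mul1r. Qed.

Definition twist_pred : {pred hom_hmodule H M} := fun f =>
  `[< forall h k x : H,
      \tsum_(h1, h2 <- Δ h) (x • (h1 • hom_fun f (S h2 * k))) =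
      \tsum_(h1, h2 <- Δ h) ((x * h1) • (S h2 • hom_fun f k)) >].

Fact twist_closed : submod_closed twist_pred.
Proof.
split=> [|a f g /asboolP Pf /asboolP Pg];
  apply/asboolP => h k x; rewrite /tsum /formal_eval.
  have E y : hom_fun (0 : hom_hmodule H M) y = 0 :> M by [].
  by rewrite !big1 // => p _; rewrite E !(linear0r, linear0).
have E y : hom_fun (a *: f + g) y = a *: hom_fun f y + hom_fun g y by [].
rewrite (eq_bigr (fun p => a *: (x • (p.1 • hom_fun f (S p.2 * k)))
  + (x • (p.1 • hom_fun g (S p.2 * k))))); last first.
  by move=> p _; rewrite E !act_linear.
rewrite [RHS](eq_bigr (fun p => a *: ((x * p.1) • (S p.2 • hom_fun f k))
  + ((x * p.1) • (S p.2 • hom_fun g k)))); last first.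
  by move=> p _; rewrite E !act_linear.
rewrite !big_split -!scaler_sumr; congr (_ *: _ + _); [exact: Pf|exact: Pg].
Qed.

Definition twist_sub : submodClosed (hom_hmodule H M) :=
  HB.pack twist_pred (GRing.isSubmodClosed.Build K _ twist_pred twist_closed).

Fact twist_stable : hstable twist_sub.
Proof.
move=> l f /asboolP Pf; apply/asboolP => h k x.
rewrite [RHS](_ : _ =
  \tsum_(h1, h2 <- Δ h) ((x * h1) • (S h2 • hom_fun f (k * l)))); last first.
  by apply: eq_bigr => p _; rewrite hom_actE.
by rewrite -Pf; apply: eq_bigr => p _; rewrite hom_actE mulrA.
Qed.

Lemma act_tsum (U V : lmodType K) (x : H) (F : U -> V -> M) (t : U ⊗ V) :
  \tsum_(h1, h2 <- t) (x • F h1 h2) = x • (\tsum_(h1, h2 <- t) F h1 h2).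
Proof. by rewrite /tsum /formal_eval linear_sumr linear_sum. Qed.

Fact twist_std (f : std_module) (h k x : H) :
  \tsum_(h1, h2 <- Δ h) (x • (h1 • std_fun f (S h2 * k))) =
  \tsum_(h1, h2 <- Δ h) ((x * h1) • (S h2 • std_fun f k)).
Proof.
case: f => f f_std; have /asboolP/(_ twist_sub twist_stable) Pf := f_std.
suff /Pf/asboolP : forall g, (exists m, phi m = g) -> g \in twist_sub by apply.
move=> _ [m <-]; apply/asboolP => {}h {}k {}x.
apply: etrans (pactMS x h (k • m)); rewrite !act_tsum; congr (x • _).
exact/esym/pactSM.
Qed.

Fact std_TS (h : H) (f : std_module) :
  \tsum_(h1, h2 <- Δ h) std_T (h1 ▷ std_T (S h2 ▷ f)) =
  \tsum_(h1, h2 <- Δ h) (h1 ▷ std_T (S h2 ▷ std_T f)).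
Proof.
apply: std_ext => x; rewrite /tsum /formal_eval !std_sumE.
transitivity (\tsum_(h1, h2 <- Δ h) (x • (h1 • std_fun f (S h2 * 1)))).
  apply: eq_bigr => p _; rewrite -[LHS]/(x • std_fun (p.1 ▷ _) 1).
  by rewrite std_actE mul1r -[std_fun _ p.1]/(p.1 • std_fun _ 1) std_actE mul1r mulr1.
rewrite twist_std; apply: eq_bigr => p _; rewrite std_actE.
rewrite -[RHS]/((x * p.1) • std_fun (S p.2 ▷ _) 1) std_actE mul1r.
by rewrite -[std_fun _ (S _)]/(S p.2 • std_fun f 1).
Qed.

Definition standard_dilation : dilation M :=
  @Dilation M std_module std_T std_phi
    std_idem std_TS std_phi_inj std_image std_phi_act.

Lemma standard_dilation_proper : proper_dilation standard_dilation.
Proof.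
move=> y; apply/asboolP => W W_stable TW.
pose P : {pred hom_hmodule H M} := fun f =>
  `[< exists2 w : std_module, w \in W & subspace_val (w : subspace std_pred) = f >].
have P_closed : submod_closed P.
  split; first by apply/asboolP; exists 0; rewrite ?rpred0.
  move=> a _ _ /asboolP[v vW <-] /asboolP[w wW <-]; apply/asboolP.
  exists (a *: v + w); last exact: subspace_val_linear.
  by apply: rpredD => //; apply: rpredZ.
pose P' : submodClosed (hom_hmodule H M) :=
  HB.pack P (GRing.isSubmodClosed.Build K _ P P_closed).
have P_stable : hstable P'.
  move=> h _ /asboolP[w wW <-]; apply/asboolP; exists (h ▷ w).
    exact: W_stable.
  exact: std_val_act.
have phiP f : (exists m, phi m = f) -> f \in P'.
  move=> [m <-]; apply/asboolP; exists (std_phi m) => //.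
  by apply: TW; apply/std_image; exists m.
case: (y) => f f_std; have /asboolP/(_ P' P_stable phiP)/asboolP[w wW wf] := f_std.
suff -> : Subspace f_std = w by [].
exact: subspaceP.
Qed.

Lemma standard_dilation_minimal : minimal_dilation standard_dilation.
Proof.
move=> W W_stable TW f fW; apply: std_ext => h.
have /(congr1 (fun g : std_module => std_fun g 1)) := TW _ (W_stable h f fW).
by rewrite /= [LHS]pact1 std_actE mul1r.
Qed.

End Standard.

Section Associated.
Variable M : partial_module.

Fact act_act_bilinear (k : H) :
  bilinear_map (fun (h : H) (m : M) => k • (h • m)).
Proof.
split=> [m|h] a x y; last by rewrite !act_linear.
by rewrite orbit_linear act_linear.
Qed.

Fact mul_act_bilinear (k : H) : bilinear_map (fun (h : H) (m : M) => (k * h) • m).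
Proof.
split=> [m|h] a x y; last by rewrite act_linear.
by rewrite mulrDr -scalerAr orbit_linear.
Qed.

Definition bullet_pred : {pred (H ⊗ M)%type} := fun t =>
  `[< forall k : H, \tsum_(h, m <- t) (k • (h • m)) = \tsum_(h, m <- t) ((k * h) • m) >].

Fact bullet_closed : submod_closed bullet_pred.
Proof.
split=> [|a s t /asboolP Ps /asboolP Pt]; apply/asboolP => k.
  by rewrite (tsum0 (act_act_bilinear k)) (tsum0 (mul_act_bilinear k)).
by rewrite (tsum_linear (act_act_bilinear k)) (tsum_linear (mul_act_bilinear k)) Ps Pt.
Qed.

Definition bullet_sub : submodClosed (H ⊗ M)%type :=
  HB.pack bullet_pred (GRing.isSubmodClosed.Build K _ bullet_pred bullet_closed).

Definition bullet := subspace bullet_sub.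
HB.instance Definition _ := GRing.Lmodule.on bullet.

Definition bullet_pi : {linear bullet -> (H ⊗ M)%type} := incl bullet_sub.
Definition bullet_rho : {linear bullet -> M} := pact M \o bullet_pi.

Fact bullet_pi_inj : injective bullet_pi.
Proof. exact: val_inj. Qed.

Definition associated_comodule : partial_comodule_datum H :=
  PartialComoduleDatum bullet_rho bullet_pi_inj.

End Associated.
End PartialModules.

(* Main.v *)
Require Import Defs.
From HB Require Import structures.
From mathcomp Require Import all_boot all_algebra.
From mathcomp Require Import boolp.

(** Write $\phi : M \to \overline M$ for the map of the standard dilation
    ([std_phi], abbreviated [sphi] below) and $\nu_\phi : H \otimes M \to
    \overline M$ for the action it induces, that is
    $\nu_\phi(h \otimes m) = h \triangleright \phi(m)$. Everything rests on three
    observations.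

    Evaluating at $k$ gives $\nu_\phi(t)(k) = \sum_i k h_i \cdot m_i$ and
    $\phi(\lambda(t))(k) = \sum_i k \cdot (h_i \cdot m_i)$ for
    $t = \sum_i h_i \otimes m_i$. The condition defining $H \bullet M$ is therefore
    the equation $\phi(\lambda(t)) = \nu_\phi(t)$ (bullet_std_phi), which is the
    compatibility of $\phi$ with $\pi_M$ and $\rho_M$.

    If $\phi(m) = \nu_\phi(t)$ for some $m$, evaluating at $1$ forces
    $m = \lambda(t)$ (std_phi_induced). Hence the pairs $(m, t)$ with
    $\phi(m) = \nu_\phi(t)$ are exactly the pairs $(\lambda(t), t)$ with
    $t \in H \bullet M$, which is the pullback property (bullet_pullback). With
    $m = 0$ it also shows that $\ker \nu_\phi$ is contained in $H \bullet M$ and is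
    killed by $\lambda$.

    Finally, $\nu_\phi$ is onto because $\overline M$ is generated by $\phi(M)$. If
    $g : M \to Z$ is compatible with $\pi_M$ and $\rho_M$, then
    $\nu_g(t) = g(\lambda(t)) = g(0) = 0$ for all $t \in \ker \nu_\phi$, so $\nu_g$
    factors uniquely through $\nu_\phi$, and the factor is the required $H$-linear
    map (hlinear_extension). *)

Set Implicit Arguments. Unset Strict Implicit. Unset Printing Implicit Defensive.
Import GRing.Theory.
Local Open Scope ring_scope.

(** The factor is [q] composed with a set-theoretic section of [p]. The section
    need not be linear, but its failure to be so lies in the kernel of [p], hence
    in that of [q]. *)
Lemma linear_factor_surj (K : fieldType) (A B C : lmodType K)
    (p : {linear A -> B}) (q : {linear A -> C}) :
  (forall b, exists a, p a = b) -> (forall a, p a = 0 -> q a = 0) ->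
  exists f : {linear B -> C}, f \o p =1 q.
Proof.
move=> p_onto ker_pq; pose sec b := projT1 (cid (p_onto b)).
have secK b : p (sec b) = b by rewrite /sec; case: cid.
have q_eq a a' : p a = p a' -> q a = q a'.
  move=> paa'; apply/eqP; rewrite -subr_eq0 -linearB; apply/eqP/ker_pq.
  by rewrite linearB paa' subrr.
pose f b := q (sec b).
have f_linear : linear f.
  move=> a x y; rewrite /f -linearP; apply: q_eq.
  by rewrite linearP !secK.
pose f' : {linear B -> C} :=
  HB.pack f (GRing.isLinear.Build K B C _ _ f_linear).
by exists f' => a /=; apply: q_eq; rewrite secK.
Qed.

Section InducedAction.
Variables (K : fieldType) (H : algType K) (V : lmodType K).

Lemma induced_action_pure (Z : hmodule H) (g : {linear V -> Z}) h v :
  induced_action g (h ⊗ v) = h ▷ g v.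
Proof. exact: (congr1 (hact Z) (tmap_pure _ _ _ _)). Qed.

Lemma induced_action_mul (Z : hmodule H) (g : {linear V -> Z}) h t :
  induced_action g (tmap (h \*o idfun) idfun t) = h ▷ induced_action g t.
Proof.
have act_linear_in_y : linear (fun y : Z => h ▷ y).
  by move=> a x y; rewrite linearDr linearZr_LR linearP.
pose act_h : {linear Z -> Z} :=
  HB.pack (fun y : Z => h ▷ y)
    (GRing.isLinear.Build K Z Z _ _ act_linear_in_y).
pose lhs : {linear (H ⊗ V)%type -> Z} :=
  induced_action g \o tmap (h \*o idfun) (idfun : {linear V -> V}).
pose rhs : {linear (H ⊗ V)%type -> Z} := act_h \o induced_action g.
apply: (tensor_linear_ext (f := lhs) (g := rhs)) => k v.
rewrite -[LHS]/(induced_action g (tmap (h \*o idfun) idfun (k ⊗ v))) tmap_pure.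
rewrite -[RHS]/(h ▷ induced_action g (k ⊗ v)).
by rewrite !induced_action_pure hactM.
Qed.

Lemma hlinear_induced_action (Y Z : hmodule H) (eps : {linear V -> Y})
    (g : {linear V -> Z}) (eta : {linear Y -> Z}) :
  hlinear eta -> eta \o eps =1 g ->
  eta \o induced_action eps =1 induced_action g.
Proof.
move=> etaH eta_eps t; pose lhs : {linear (H ⊗ V)%type -> Z} :=
  eta \o induced_action eps.
apply: (tensor_linear_ext (f := lhs)) => h v.
rewrite -[LHS]/(eta (induced_action eps (h ⊗ v))).
by rewrite !induced_action_pure etaH -eta_eps.
Qed.

(** The image of the induced action is a submodule, and it contains the image of
    [eps] because [1] acts as the identity. *)
Lemma induced_action_surj (Y : hmodule H) (eps : {linear V -> Y}) (y : Y) :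
  y \in hgen (fun z => exists v, eps v = z) ->
  exists t, induced_action eps t = y.
Proof.
pose P : {pred Y} := fun y => `[< exists t, induced_action eps t = y >].
have P_closed : submod_closed P.
  split=> [|a _ _ /asboolP[s <-] /asboolP[t <-]]; apply/asboolP.
    by exists 0; rewrite linear0.
  by exists (a *: s + t); rewrite linearP.
pose P' : submodClosed Y :=
  HB.pack P (GRing.isSubmodClosed.Build K Y P P_closed).
have P_stable : hstable P'.
  move=> h _ /asboolP[t <-]; apply/asboolP.
  by exists (tmap (h \*o idfun) idfun t); rewrite induced_action_mul.
move=> /asboolP/(_ P' P_stable) y_in; apply/asboolP/y_in => _ [v <-].
by apply/asboolP; exists (1 ⊗ v); rewrite induced_action_pure hact1.
Qed.

(** A generated module is the quotient of $H \otimes V$ by the kernel of the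
    induced action of [eps], so extending [g] amounts to factoring its own induced
    action through this quotient. Linearity of the factor over [H] is inherited
    from the fact that both induced actions intertwine multiplication on the left
    tensor factor. *)
Lemma hlinear_extension (Y Z : hmodule H) (eps : {linear V -> Y})
    (g : {linear V -> Z}) :
  (forall y, y \in hgen (fun z => exists v, eps v = z)) ->
  (forall t, induced_action eps t = 0 -> induced_action g t = 0) ->
  exists eta : {linear Y -> Z},
    (hlinear eta /\ eta \o eps =1 g) /\
    forall eta' : {linear Y -> Z},
      hlinear eta' /\ eta' \o eps =1 g -> eta' =1 eta.
Proof.
move=> Y_gen rel_g; have onto y := induced_action_surj (Y_gen y).
have [eta etaE] := linear_factor_surj onto rel_g.
exists eta; split; first split.
- move=> h y; have [t <-] := onto y.
  rewrite -induced_action_mul.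
  by rewrite (etaE t : eta _ = _) (etaE _ : eta _ = _) induced_action_mul.
- move=> v; have := etaE (1 ⊗ v).
  rewrite -[LHS]/(eta (induced_action eps (1 ⊗ v))).
  by rewrite !induced_action_pure !hact1.
move=> eta' [etaH' eta_eps'] y; have [t <-] := onto y.
rewrite (etaE t : eta _ = _).
exact: (hlinear_induced_action etaH' eta_eps').
Qed.

End InducedAction.

Section StandardDilation.
Variables (K : fieldType) (H : hopfAlgebra K) (M : partial_module H).

Let sphi : {linear M -> std_module M} := @std_phi K H M.

Lemma std_fun_linear (k : H) : linear (fun f : std_module M => std_fun f k).
Proof. by []. Qed.

Lemma std_fun_induced (t : H ⊗ M) (k : H) :
  std_fun (induced_action sphi t) k = \tsum_(h, m <- t) pact M ((k * h) ⊗ m).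
Proof.
pose ev : {linear std_module M -> M} :=
  HB.pack (fun f : std_module M => std_fun f k)
    (GRing.isLinear.Build K (std_module M) M _ _ (std_fun_linear k)).
pose lhs : {linear (H ⊗ M)%type -> M} := ev \o induced_action sphi.
apply: (tensor_linear_ext (f := lhs) (g := tlift (mul_act_bilinear M k))) => h m.
rewrite tlift_pure.
rewrite -[LHS]/(std_fun (induced_action sphi (h ⊗ m)) k) induced_action_pure.
exact: std_actE.
Qed.

(** Both sides of the equation defining $H \bullet M$ are values at $k$ of elements
    of $\overline M$. *)
Lemma bullet_std_phi (t : H ⊗ M) :
  t \in bullet_sub M <-> sphi (pact M t) = induced_action sphi t.
Proof.
have std_fun_phi k :
    std_fun (sphi (pact M t)) k = \tsum_(h, m <- t) pact M (k ⊗ pact M (h ⊗ m)).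
  by rewrite act_tsum (tsum_comp (pact M)).
split=> [/asboolP t_bullet | phi_t].
  by apply: std_ext => k; rewrite std_fun_phi std_fun_induced.
by apply/asboolP => k; rewrite -std_fun_phi -std_fun_induced phi_t.
Qed.

Lemma std_phi_induced (m : M) (t : H ⊗ M) :
  sphi m = induced_action sphi t -> m = pact M t.
Proof.
move=> /(congr1 (fun f => std_fun f 1)); rewrite std_fun_induced.
rewrite [LHS]pact1 => ->; rewrite -[RHS](tsum_comp (pact M)).
by apply: eq_bigr => p _; rewrite mul1r.
Qed.

Lemma bullet_pullback :
  is_pullback sphi (induced_action sphi) (bullet_rho M) (bullet_pi M).
Proof.
split=> [t | W r s rs]; first exact: (bullet_std_phi _).1 (valP t).
have r_eq w : r w = pact M (s w) := std_phi_induced (rs w).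
have s_bullet w : s w \in bullet_sub M.
  by apply/bullet_std_phi; rewrite -r_eq; exact: rs.
pose u w : bullet M := Subspace (s_bullet w).
have u_linear : linear u by move=> a x y; apply: subspaceP; rewrite /= linearP.
pose u' : {linear W -> bullet M} :=
  HB.pack u (GRing.isLinear.Build K W (bullet M) _ _ u_linear).
exists u'; split; first by split=> w //=; rewrite r_eq.
by move=> v [_ vs] w; apply: subspaceP; exact: vs.
Qed.

(** An element $t$ of the kernel satisfies $\phi(0) = \nu_\phi(t)$, so
    $\lambda(t) = 0$ and $t$ lies in $H \bullet M$. *)
Lemma ker_induced_std_phi (t : H ⊗ M) :
  induced_action sphi t = 0 -> t \in bullet_sub M /\ pact M t = 0.
Proof.
move=> t0; have pact_t : 0 = pact M t.
  by apply: std_phi_induced; rewrite t0 linear0.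
by split; [apply/bullet_std_phi; rewrite -pact_t t0 linear0 | rewrite -pact_t].
Qed.

(** The standard dilation is proper, and the image of its idempotent is the image
    of [sphi]. *)
Lemma std_module_generated (y : std_module M) :
  y \in hgen (fun z => exists m, sphi m = z).
Proof.
apply/asboolP => W W_stable sphiW.
have /asboolP := standard_dilation_proper (M := M) y.
by apply=> // z /std_image; exact: sphiW.
Qed.

End StandardDilation.

Theorem theorem3p13 (K : fieldType) (H : hopfAlgebra K) (M : partial_module H) :
  is_globalization (X := associated_comodule M) (Y := dil_mod (standard_dilation M))
    (dil_theta (standard_dilation M)).
Proof.
have pb := bullet_pullback M; split=> //; first exact: pb.1.
move=> Z g g_compat; apply: hlinear_extension; first exact: std_module_generated.
move=> t /ker_induced_std_phi[t_bullet pact_t].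
have := g_compat (Subspace t_bullet : bullet M).
by rewrite [LHS]/= pact_t linear0 => /esym.
Qed.
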